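(* Let $\mathfrak{g}$ be a Lie algebra and $(M,\bullet)$ a $\mathfrak{g}$-module. Let $N\in\mathrm{End}(\mathfrak{g})$, $S\in\mathrm{End}(M)$, $T:M\to\mathfrak{g}$ and $\sigma:\mathfrak{g}\to M$ be linear maps, and let $J:\mathfrak{g}\oplus M\to\mathfrak{g}\oplus M$ be the linear map $J = \begin{pmatrix} N & T\\ \sigma & -S\end{pmatrix}$, i.e. $J(x,m) = (Nx+Tm,\ \sigma x - Sm)$. Then $J$ is a generalized complex structure on $M$ over $\mathfrak{g}$ if and only if the following identities hold for all $x,y\in\mathfrak{g}$ and $m,n\in M$: \begin{align*} NT &= TS,\\ N^2 + T\sigma &= -\mathrm{id},\\ S\sigma &= \sigma N,\\ S^2+\sigma T &= -\mathrm{id},\\ T([m,n]^T) &= [Tm,Tn],\\ S([m,n]^T) &= Tm\bullet Sn - Tn\bullet Sm,\\ [Nx,Tm] - N[x,Tm] &= T(Nx\bullet m - x\bullet Sm),\\ \sigma[Tm,x] - Tm\bullet\sigma x &= x\bullet m + Nx\bullet Sm - S(Nx\bullet m - x\bullet Sm),\\ [Nx,Ny]-[x,y]-N([Nx,y]+[x,Ny]) &= T(x\bullet\sigma y - y\bullet\sigma x),\\ Nx\bullet\sigma y - Ny\bullet\sigma x - \sigma([Nx,y]+[x,Ny]) &= -S(x\bullet\sigma y - y\bullet\sigma x). \end{align*}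
   Context: All vector spaces are over a field of characteristic $0$. $[m,n]^T := T(m)\bullet n - T(n)\bullet m$. On $\mathfrak{g}\oplus M$ consider the semi-direct product Lie bracket $[(x,m),(y,n)] = ([x,y],\ x\bullet n - y\bullet m)$. A generalized complex structure on $M$ over $\mathfrak{g}$ is a linear map $J:\mathfrak{g}\oplus M\to\mathfrak{g}\oplus M$ with $J^2=-\mathrm{id}$ and $[Ju,Jv]-[u,v]-J([Ju,v]+[u,Jv])=0$ for all $u,v\in\mathfrak{g}\oplus M$. *)

(* Defs.v *)
From HB Require Import structures.
From mathcomp Require Import all_boot all_order all_algebra ssrAC.

Set Implicit Arguments.
Unset Strict Implicit.
Unset Printing Implicit Defensive.

Import GRing.Theory.
Local Open Scope ring_scope.

HB.mixin Record Lmodule_isLieAlgebra (K : fieldType) g of GRing.Lmodule K g := {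
  lie_bracket : g -> g -> g;
  lie_linearl : forall y, linear (lie_bracket^~ y);
  lie_linearr : forall x, linear (lie_bracket x);
  lie_alternating : forall x, lie_bracket x x = 0;
  lie_jacobi : forall x y z,
    lie_bracket x (lie_bracket y z) + lie_bracket y (lie_bracket z x)
      + lie_bracket z (lie_bracket x y) = 0
}.

#[short(type="lieAlgType")]
HB.structure Definition LieAlgebra (K : fieldType) :=
  { g of GRing.Lmodule K g & Lmodule_isLieAlgebra K g }.

Notation "[ 'lie' x , y ]" := (lie_bracket x y)
  (at level 0, format "[ 'lie'  x ,  y ]") : ring_scope.

HB.mixin Record Lmodule_isLieModule (K : fieldType) (g : lieAlgType K) M
    of GRing.Lmodule K M := {
  lie_act : g -> M -> M;
  lie_act_linearl : forall m, linear (lie_act^~ m);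
  lie_act_linearr : forall x, linear (lie_act x);
  lie_act_bracket : forall x y m,
    lie_act [lie x, y] m = lie_act x (lie_act y m) - lie_act y (lie_act x m)
}.

#[short(type="lieModType")]
HB.structure Definition LieModule (K : fieldType) (g : lieAlgType K) :=
  { M of GRing.Lmodule K M & Lmodule_isLieModule K g M }.

Notation "x \act m" := (lie_act x m)
  (at level 40, left associativity) : ring_scope.

(* An alias of the product, so that its Lie algebra instance is the
   semi-direct product and not the direct one. *)
Definition semidirect (K : fieldType) (g : lieAlgType K) (M : lieModType g)
  : Type := (g * M)%type.

#[warnings="-redundant-canonical-projection"]
HB.instance Definition _ (K : fieldType) (g : lieAlgType K) (M : lieModType g) :=
  GRing.Lmodule.copy (semidirect M) (g * M)%type.

Section SemiDirect.
Variables (K : fieldType) (g : lieAlgType K) (M : lieModType g).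
Implicit Types (u v w : semidirect M) (x : g) (m n : M).

Lemma lie_actBr x m n : x \act (m - n) = x \act m - x \act n.
Proof.
by have := lie_act_linearr x (-1) n m; rewrite !scaleN1r ![- _ + _]addrC.
Qed.

Definition sd_bracket u v : semidirect M :=
  ([lie u.1, v.1], u.1 \act v.2 - v.1 \act u.2).

Lemma sd_linearl v : linear (sd_bracket^~ v).
Proof.
move=> a u w; congr pair; first exact: lie_linearl.
by rewrite /= lie_act_linearl lie_act_linearr opprD scalerBr addrACA.
Qed.

Lemma sd_linearr u : linear (sd_bracket u).
Proof.
move=> a v w; congr pair; first exact: lie_linearr.
by rewrite /= lie_act_linearl lie_act_linearr opprD scalerBr addrACA.
Qed.

Lemma sd_alternating u : sd_bracket u u = 0.
Proof. by rewrite /sd_bracket lie_alternating subrr. Qed.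

Lemma sd_jacobi u v w :
  sd_bracket u (sd_bracket v w) + sd_bracket v (sd_bracket w u)
    + sd_bracket w (sd_bracket u v) = 0.
Proof.
congr pair; first exact: lie_jacobi.
rewrite /= !lie_actBr !lie_act_bracket !opprB.
rewrite (AC ((2*2)*(2*2)*(2*2))
            ((1*12)*(7*2)*(3*10)*(5*4)*(11*6)*(9*8))) /=.
by rewrite !subrr !addr0.
Qed.

HB.instance Definition _ :=
  Lmodule_isLieAlgebra.Build K (semidirect M)
    sd_linearl sd_linearr sd_alternating sd_jacobi.

End SemiDirect.

Section GeneralizedComplex.
Variables (K : fieldType) (g : lieAlgType K) (M : lieModType g).

Definition T_bracket (T : M -> g) (m n : M) : M := T m \act n - T n \act m.

Definition generalized_complex
    (J : {linear semidirect M -> semidirect M}) : Prop :=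
  (forall u, J (J u) = - u) /\
  (forall u v,
     [lie J u, J v] - [lie u, v] - J ([lie J u, v] + [lie u, J v]) = 0).

Variables (N : {linear g -> g}) (T : {linear M -> g})
          (sigma : {linear g -> M}) (S : {linear M -> M}).

Definition block_J (u : semidirect M) : semidirect M :=
  (N u.1 + T u.2, sigma u.1 - S u.2).

Lemma block_J_linear : linear block_J.
Proof.
move=> a u v; congr pair; rewrite /= !linearP /=.
  by rewrite scalerDr addrACA.
by rewrite scalerBr scalerN addrACA.
Qed.

HB.instance Definition _ :=
  GRing.isLinear.Build K (semidirect M) (semidirect M) _ block_J block_J_linear.

End GeneralizedComplex.

(* Main.v *)
(** The Nijenhuis torsion of a linear map on a Lie algebra is biadditive and
    skew-symmetric, so on the semi-direct product it vanishes as soon as it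
    vanishes on the three kinds of pairs of homogeneous elements (g, g), (g, M)
    and (M, M). Each kind contributes two of the last six identities, one per
    component; the first four are the blocks of [J^2 = - id]. *)
Require Import Defs.
From HB Require Import structures.
From mathcomp Require Import all_boot all_order all_algebra.

Set Implicit Arguments.
Unset Strict Implicit.
Unset Printing Implicit Defensive.

Import GRing.Theory.
Local Open Scope ring_scope.

Section LieAlgebraTheory.
Variables (K : fieldType) (L : lieAlgType K).
Implicit Types x y z : L.

Lemma lieDl x y z : [lie x + y, z] = [lie x, z] + [lie y, z].
Proof. by have := lie_linearl z 1 x y; rewrite !scale1r. Qed.

Lemma lieDr x y z : [lie x, y + z] = [lie x, y] + [lie x, z].
Proof. by have := lie_linearr x 1 y z; rewrite !scale1r. Qed.

Lemma lie0l x : [lie 0, x] = 0.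
Proof. by apply: (addrI [lie 0, x]); rewrite -lieDl !addr0. Qed.

Lemma lie0r x : [lie x, 0] = 0.
Proof. by apply: (addrI [lie x, 0]); rewrite -lieDr !addr0. Qed.

Lemma lieC x y : [lie x, y] = - [lie y, x].
Proof.
apply/eqP; rewrite -addr_eq0; apply/eqP.
have := lie_alternating (x + y).
by rewrite lieDl !lieDr !lie_alternating add0r addr0.
Qed.

(** The term [J (J [lie x, y])] of the usual Nijenhuis torsion appears as [- [lie x, y]], its value
    when $J^2 = -\mathrm{id}$. *)
Definition nijenhuis (J : {linear L -> L}) x y : L :=
  [lie J x, J y] - [lie x, y] - J ([lie J x, y] + [lie x, J y]).

Variable J : {linear L -> L}.

Lemma nijenhuisC x y : nijenhuis J x y = - nijenhuis J y x.
Proof.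
rewrite /nijenhuis (lieC (J x)) (lieC x y) (lieC (J x) y) (lieC x (J y)).
by rewrite -!opprD raddfN [[lie y, J x] + _]addrC.
Qed.

Lemma nijenhuisDr x y z :
  nijenhuis J x (y + z) = nijenhuis J x y + nijenhuis J x z.
Proof.
rewrite /nijenhuis (raddfD J y) !lieDr (addrACA [lie J x, y]) (raddfD J) !opprD.
by rewrite [RHS]addrACA; congr (_ + _); rewrite addrACA.
Qed.

(** Skew-symmetry, used before and after, carries this over from additivity on the right. *)
Lemma nijenhuisDl x y z :
  nijenhuis J (x + y) z = nijenhuis J x z + nijenhuis J y z.
Proof. by rewrite nijenhuisC nijenhuisDr opprD -!(nijenhuisC _ z). Qed.

End LieAlgebraTheory.

Section LieModuleTheory.
Variables (K : fieldType) (g : lieAlgType K) (M : lieModType g).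

Lemma lie_act0l (m : M) : (0 : g) \act m = 0.
Proof.
by have := lie_act_linearl m (-1) 0 0; rewrite !scaleN1r oppr0 addr0 addNr.
Qed.

Lemma lie_act0r (x : g) : x \act (0 : M) = 0.
Proof. by rewrite -[0 in LHS](subrr 0) lie_actBr subrr. Qed.

Lemma lie_actNr (x : g) (m : M) : x \act (- m) = - (x \act m).
Proof. by rewrite -[- m]sub0r lie_actBr lie_act0r sub0r. Qed.

End LieModuleTheory.

Section BlockJ.
Variables (K : fieldType) (g : lieAlgType K) (M : lieModType g).
Variables (N : {linear g -> g}) (T : {linear M -> g}).
Variables (sigma : {linear g -> M}) (S : {linear M -> M}).
Implicit Types (x y : g) (m n : M).

Local Notation J := (block_J N T sigma S).
Local Notation nij := (nijenhuis (block_J N T sigma S)).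

Definition sd_inl x : semidirect M := (x, 0).
Definition sd_inr m : semidirect M := (0, m).

Lemma sd_decomp (u : semidirect M) : u = sd_inl u.1 + sd_inr u.2.
Proof. by case: u => x m; congr pair; rewrite /= ?addr0 ?add0r. Qed.

(** True by conversion; as a rewrite rule it unfolds the semi-direct bracket and keeps the brackets
    of [g] folded. *)
Lemma sd_bracketE (u v : semidirect M) :
  [lie u, v] = ([lie u.1, v.1], u.1 \act v.2 - v.1 \act u.2).
Proof. by []. Qed.

Lemma block_J_inl x : J (sd_inl x) = (N x, sigma x).
Proof. by rewrite /block_J /= (raddf0 T) (raddf0 S) addr0 subr0. Qed.

Lemma block_J_inr m : J (sd_inr m) = (T m, - S m).
Proof. by rewrite /block_J /= !raddf0 !add0r. Qed.

Lemma block_J2_inl x :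
  J (J (sd_inl x)) = (N (N x) + T (sigma x), sigma (N x) - S (sigma x)).
Proof. by rewrite block_J_inl. Qed.

Lemma block_J2_inr m :
  J (J (sd_inr m)) = (N (T m) - T (S m), S (S m) + sigma (T m)).
Proof. by rewrite block_J_inr /block_J /= !raddfN opprK [sigma _ + _]addrC. Qed.

Lemma nijenhuis_blockE (u v : semidirect M) :
  nij u v = [lie J u, J v] - [lie u, v] - J ([lie J u, v] + [lie u, J v]).
Proof. by []. Qed.

(** The components vanish exactly when the last two identities hold for [x] and [y]. *)
Lemma nijenhuis_inl_inl x y :
  nij (sd_inl x) (sd_inl y) =
  ([lie N x, N y] - [lie x, y] - N ([lie N x, y] + [lie x, N y])
     - T (x \act sigma y - y \act sigma x),
   N x \act sigma y - N y \act sigma x - sigma ([lie N x, y] + [lie x, N y])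
     + S (x \act sigma y - y \act sigma x)).
Proof.
rewrite nijenhuis_blockE !block_J_inl !sd_bracketE /block_J /=.
rewrite !lie_act0r !subr0 !sub0r [- _ + _]addrC.
by congr pair; rewrite /= ?subr0 opprD ?opprK addrA.
Qed.

(** Each component is left side minus right side of an identity: the seventh, then the eighth. *)
Lemma nijenhuis_inl_inr x m :
  nij (sd_inl x) (sd_inr m) =
  ([lie N x, T m] - N [lie x, T m] - T (N x \act m - x \act S m),
   sigma [lie T m, x] - T m \act sigma x
     - (x \act m + N x \act S m - S (N x \act m - x \act S m))).
Proof.
rewrite nijenhuis_blockE block_J_inl block_J_inr !sd_bracketE /block_J /=.
rewrite !lie_act0r !lie_act0l !lie_actNr !lie0r !subr0.
congr pair; rewrite /= ?lie0r ?add0r ?subr0; first by rewrite opprD addrA.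
(* The torsion produces [- sigma [lie x, T m]], while the identity is written with
   [[lie T m, x]]. *)
rewrite (lieC (T m)) raddfN !opprD !opprK.
by rewrite (AC (3*2) (4*2*(3*1)*5)) /= ?addrA.
Qed.

(** The fifth and sixth identities, as right minus left and left minus right respectively. *)
Lemma nijenhuis_inr_inr m n :
  nij (sd_inr m) (sd_inr n) =
  ([lie T m, T n] - T (T_bracket T m n),
   S (T_bracket T m n) - (T m \act S n - T n \act S m)).
Proof.
rewrite nijenhuis_blockE !block_J_inr !sd_bracketE /block_J /T_bracket /=.
rewrite !lie_act0l !lie_actNr !lie0r !lie0l !subr0 !sub0r.
congr pair; rewrite /= ?addr0 ?raddf0 ?subr0 ?add0r ?opprK //.
by rewrite addrC opprB [- _ + _]addrC.
Qed.

End BlockJ.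

Theorem theorem7p2 (K : fieldType) (charK0 : [pchar K] =i pred0)
    (g : lieAlgType K) (M : lieModType g)
    (N : {linear g -> g}) (S : {linear M -> M})
    (T : {linear M -> g}) (sigma : {linear g -> M}) :
  generalized_complex (block_J N T sigma S) <->
  (forall (x y : g) (m n : M),
     N (T m) = T (S m) /\
     N (N x) + T (sigma x) = - x /\
     S (sigma x) = sigma (N x) /\
     S (S m) + sigma (T m) = - m /\
     T (T_bracket T m n) = [lie T m, T n] /\
     S (T_bracket T m n) = T m \act S n - T n \act S m /\
     [lie N x, T m] - N [lie x, T m] = T (N x \act m - x \act S m) /\
     sigma [lie T m, x] - T m \act sigma x
       = x \act m + N x \act S m - S (N x \act m - x \act S m) /\
     [lie N x, N y] - [lie x, y] - N ([lie N x, y] + [lie x, N y])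
       = T (x \act sigma y - y \act sigma x) /\
     N x \act sigma y - N y \act sigma x - sigma ([lie N x, y] + [lie x, N y])
       = - S (x \act sigma y - y \act sigma x)).
Proof.
split=> [[J2 Jnij] x y m n | H].
  (* Evaluating both conditions on homogeneous elements gives equalities of pairs, which injectivity
     of pairing splits into the identities. *)
  have [N2 sN] : (_, _) = (_, _) := etrans (esym (block_J2_inl _ _ _ _ x)) (J2 _).
  have [NT S2] : (_, _) = (_, _) := etrans (esym (block_J2_inr _ _ _ _ m)) (J2 _).
  have [TT ST] : (_, _) = (0, 0) :=
    etrans (esym (nijenhuis_inr_inr N T sigma S m n)) (Jnij _ _).
  have [gm mg] : (_, _) = (0, 0) :=
    etrans (esym (nijenhuis_inl_inr N T sigma S x m)) (Jnij _ _).
  have [gg ss] : (_, _) = (0, 0) :=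
    etrans (esym (nijenhuis_inl_inl N T sigma S x y)) (Jnij _ _).
  (* These [- 0] are the zero components of [- sd_inl x] and [- sd_inr m]. *)
  rewrite oppr0 in sN; rewrite oppr0 in NT.
  move/eqP: ss; rewrite addr_eq0 => /eqP ss.
  move: (subr0_eq NT) (subr0_eq sN) (subr0_eq TT) (subr0_eq ST) (subr0_eq gm).
  by move: (subr0_eq mg) (subr0_eq gg); do !split.
have nij_rr m n : nijenhuis (block_J N T sigma S) (sd_inr m) (sd_inr n) = 0.
  rewrite nijenhuis_inr_inr.
  (* The fifth and sixth identities involve only [m] and [n], so [0] fills the places of [x] and
     [y]. *)
  by have [_ [_ [_ [_ [-> [-> _]]]]]] := H 0 0 m n; rewrite !subrr.
have nij_lr x m : nijenhuis (block_J N T sigma S) (sd_inl M x) (sd_inr m) = 0.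
  rewrite nijenhuis_inl_inr.
  by have [_ [_ [_ [_ [_ [_ [-> [-> _]]]]]]]] := H x 0 m 0; rewrite !subrr.
have nij_ll x y : nijenhuis (block_J N T sigma S) (sd_inl M x) (sd_inl M y) = 0.
  rewrite nijenhuis_inl_inl.
  have [_ [_ [_ [_ [_ [_ [_ [_ [-> ->]]]]]]]]] := H x y 0 0.
  by rewrite subrr addNr.
split=> [u | u v].
  (* Both sides are additive in [u], so the square is computed on each summand. *)
  rewrite (sd_decomp u) !raddfD /= block_J2_inl block_J2_inr.
  have [-> [-> [-> [-> _]]]] := H u.1 0 u.2 0.
  by rewrite !subrr; congr pair; rewrite /= oppr0 ?addr0 ?add0r.
rewrite -/(nijenhuis _ u v) (sd_decomp u) (sd_decomp v).
(* Of the four resulting terms, the third pairs [M] with [g]; skew-symmetry brings it to the case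
   [nij_lr]. *)
rewrite !(nijenhuisDl, nijenhuisDr) [X in _ + (X + _)]nijenhuisC.
by rewrite !(nij_ll, nij_lr, nij_rr) oppr0 !addr0.
Qed.
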